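(* Let $A$ be a finite non-empty alphabet and let $w\in A^{\mathbb N}$ be an infinite word that satisfies the $(k,l)$-condition for some integers $k\ge 2$ and $l\ge 0$. Then for each positive integer $P$ the word $w$ contains a factor $u$ with $|u|_{\rm pal}>P$.
   Context: A palindrome is a finite word equal to its reversal; the empty word and all letters are palindromes. The palindromic length $|u|_{\rm pal}$ of a finite non-empty word $u$ is the least $n$ such that $u=v_1\cdots v_n$ with each $v_i$ a palindrome. For an infinite word $w=w_1w_2\cdots$, $w[i..j]$ denotes the occurrence (positions $i$ to $j$) of the factor $w_iw_{i+1}\cdots w_j$, $i\ge 1$. Fractional powers: if $|x|$ is divisible by $q$, then $x^{p/q}$ is the word $x^{\lfloor p/q\rfloor}x'$, where $x'$ is the prefix of $x$ of length $\{p/q\}\,|x|$ (here $x$ is a non-empty word and $\{\cdot\}$ is the fractional part). A word is a $k'$-power (for rational $k'$) if it equals $x^{k'}$ for some non-empty word $x$. For an integer $k>0$, a $k$-run in $w$ is an occurrence $w[i..j]$ such that the word $w[i..j]$ is a $k'$-power for some (possibly fractional) $k'\ge k$, but neither $w[i-1..j]$ nor $w[i..j+1]$ is a $k''$-power for any $k''\ge k$ (if $i=1$, the condition on $w[i-1..j]$ is void). A $k$-run $w[i..j]$ covers position $x$ if $i\le x\le j$. $r_{w,k}(n)$ denotes the number of $k$-runs of $w$ covering position $n$. The word $w$ satisfies the $(k,l)$-condition if it is not ultimately periodic and $r_{w,k}(n)\le l$ for all positions $n$. *)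

(* Defs.v *)
From HB Require Import structures.
From mathcomp Require Import all_boot all_order all_algebra.
From mathcomp Require Import boolp classical_sets functions cardinality.

Set Implicit Arguments.
Unset Strict Implicit.
Unset Printing Implicit Defensive.

Import Order.TTheory GRing.Theory Num.Theory.

(* Infinite words are functions [w : nat -> A] whose positions are numbered
   from 0, so that the first letter is [w 0]. *)

Section PalindromicLength.
Variable A : eqType.
Implicit Type u v : seq A.

Definition palindrome v : bool := v == rev v.

Definition pal_factorization u (n : nat) : Prop :=
  exists vs : seq (seq A),
    [/\ size vs = n, all palindrome vs & u = flatten vs].

Lemma pal_factorization_exists u : exists n, `[< pal_factorization u n >].
Proof.
exists (size u); apply/asboolP; exists [seq [:: a] | a <- u].
split; first by rewrite size_map.
  by apply/allP => v /mapP[a _ ->]; rewrite /palindrome.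
by elim: u => //= a u <-.
Qed.

(* On the empty word, where the palindromic length is usually left undefined,
   this takes the value 0. *)
Definition pal_length u : nat := ex_minn (pal_factorization_exists u).

End PalindromicLength.

Section Powers.
Variable A : eqType.
Implicit Type x v : seq A.

(* x^(p/q), meaningful when q > 0 divides |x|: the fractional part of p/q is
   (p mod q)/q, so the last, incomplete, copy of x is cut at length
   {p/q}|x| = (p mod q)(|x|/q). *)
Definition frac_power x (p q : nat) : seq A :=
  flatten (nseq (p %/ q) x) ++ take (p %% q * (size x %/ q)) x.

Definition is_power (r : rat) v : Prop :=
  exists x (p q : nat),
    [/\ x != [::], 0 < q, r = (p%:R / q%:R)%R, q %| size x
      & v = frac_power x p q].

Definition is_power_ge (k : nat) v : Prop :=
  exists r : rat, (k%:R <= r)%R /\ is_power r v.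

End Powers.

Section InfiniteWords.
Variable A : eqType.
Implicit Type w : nat -> A.

(* The word w_i ... w_j, both ends included; empty when j < i. *)
Definition subword w (i j : nat) : seq A := [seq w m | m <- index_iota i j.+1].

Definition factor w (u : seq A) : Prop := exists i j, u = subword w i j.

Definition is_run w (k i j : nat) : Prop :=
  [/\ i <= j, is_power_ge k (subword w i j),
      0 < i -> ~ is_power_ge k (subword w i.-1 j)
    & ~ is_power_ge k (subword w i j.+1)].

Definition runs_covering w (k n : nat) : set (nat * nat) :=
  [set ij | is_run w k ij.1 ij.2 /\ ij.1 <= n <= ij.2]%classic.

Definition ultimately_periodic w : Prop :=
  exists N p : nat, 0 < p /\ forall n, N <= n -> w (n + p) = w n.

(* The number of runs covering a position is a priori possibly infinite;
   "at most l" is a comparison of cardinals with {0, ..., l-1}. *)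
Definition kl_condition w (k l : nat) : Prop :=
  ~ ultimately_periodic w /\
  forall n : nat, (runs_covering w k n #<= `I_l)%card.

End InfiniteWords.

(* Main.v *)
Require Import Defs.
From HB Require Import structures.
From mathcomp Require Import all_boot all_order all_algebra.
From mathcomp Require Import boolp classical_sets functions cardinality.
From mathcomp Require Import zify.

Set Implicit Arguments.
Unset Strict Implicit.
Unset Printing Implicit Defensive.

(** Fix a family B of finite words, called blocks, that contains the letters
    and is closed under factors and reversal, and measure a word u by the least
    number of blocks whose concatenation is u. This measure is monotone,
    invariant under reversal and, up to an error of 1, additive.

    Few blocks. Suppose that every factor of u of exponent at least k is a
    block, and that all prefixes of u are products of P palindromes. Then u is a
    product of boundedly many blocks ([few_blocks]). Indeed, if one palindrome
    is a proper prefix of another one, the difference of their lengths is a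
    period of the longer one. So among the palindromes that start at a given
    position and are not blocks, each is longer than the previous one by a
    factor at least k/(k-1). After k steps the length has doubled, the longer
    palindrome contains two disjoint copies of the shorter one, and its measure
    has doubled too, up to the additive error: there are O(log M) such
    palindromes when u is a product of M blocks ([size_sporadic]). Reflecting in
    the centre of a palindrome that starts inside an interval of measure K and
    leaves it, one finds that the positions reached from the interval by one
    palindrome lie in O(log M) intervals of measure at most 2K+1
    ([reach_interval]). After P palindromes, all positions of u lie in
    O(log M)^P intervals of measure less than 2^P. So M is at most
    O(log M)^P, which bounds M.

    It remains to find a family B for which w has factors of arbitrarily large
    measure in which all powers of exponent at least k are blocks; such a B is
    called [rich] below. Start with the words of length at most 1. If B is not
    rich, there is M such that every factor of w that is not a product of M
    blocks contains a power that is not a block. Replace B by the family of the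
    words with a period p such that all factors of length at most p are products
    of M old blocks ([periodic_blocks]). As w is not ultimately periodic, its
    prefixes still have unbounded measure ([unsplittable_periodic]). A power
    that is not a new block contains, within the length of its minimal period, a
    power that is not an old block. Hence after d replacements a power that is
    not a block contains a chain of d nested powers, each one no longer than the
    minimal period of the previous one ([tower]). Each of them extends to a run
    with the same period, these runs are distinct, and they cover a common
    position ([tower_runs]). So the (k,l)-condition stops the construction after
    at most l + 1 replacements. *)

(** * Factors, palindromes and periods of an infinite word *)
Section Factors.
Variable A : eqType.
Implicit Types (w : nat -> A) (u v : seq A).

(** Half-open, unlike [subword]: consecutive factors concatenate without index
    shifts, and the empty factor is available at every position. *)
Definition fac w i j : seq A := [seq w m | m <- iota i (j - i)].

Lemma size_fac w i j : size (fac w i j) = j - i.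
Proof. by rewrite size_map size_iota. Qed.

Lemma nth_fac x0 w i j n : n < j - i -> nth x0 (fac w i j) n = w (i + n).
Proof. by move=> lt_n; rewrite (nth_map 0) ?size_iota // nth_iota. Qed.

Lemma fac_nil w i : fac w i i = [::].
Proof. by rewrite /fac subnn. Qed.

Lemma fac_cat w i j m : i <= j -> j <= m -> fac w i m = fac w i j ++ fac w j m.
Proof.
move=> le_ij le_jm; rewrite /fac -map_cat.
have -> : m - i = (j - i) + (m - j) by lia.
by rewrite iotaD; have -> : i + (j - i) = j by lia.
Qed.

Lemma fac_cat3 w x a b y : x <= a -> a <= b -> b <= y ->
  fac w x y = fac w x a ++ fac w a b ++ fac w b y.
Proof. by move=> ? ? ?; rewrite -!fac_cat //; lia. Qed.

Lemma fac_eq_cat w i j u v : i <= j -> fac w i j = u ++ v ->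
  [/\ i + size u <= j, u = fac w i (i + size u) & v = fac w (i + size u) j].
Proof.
move=> le_ij def_uv.
have le_j : i + size u <= j.
  by move/(congr1 size): def_uv; rewrite size_fac size_cat; lia.
have := def_uv; rewrite (fac_cat _ (leq_addr _ _) le_j) => /eqP.
by rewrite eqseq_cat ?size_fac ?addKn // => /andP[/eqP def_u /eqP def_v].
Qed.

Definition pal_on w x y := forall m, x <= m -> m < y -> w m = w (x + y - m.+1).

Lemma palindrome_fac w x y : x <= y -> palindrome (fac w x y) -> pal_on w x y.
Proof.
move=> le_xy /eqP pal m le_m lt_m.
have /(congr1 (fun s => nth (w 0) s (m - x))) := pal.
rewrite nth_rev size_fac ?nth_fac; try lia.
by rewrite subnKC // => ->; congr (w _); lia.
Qed.

Lemma pal_on_rev w x y a b : pal_on w x y -> x <= a -> a <= b -> b <= y ->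
  fac w (x + y - b) (x + y - a) = rev (fac w a b).
Proof.
move=> pal le_xa le_ab le_by.
apply: (@eq_from_nth _ (w 0)); rewrite ?size_rev !size_fac; first lia.
move=> m lt_m; rewrite nth_rev size_fac ?nth_fac; try lia.
by rewrite [RHS]pal; try lia; congr (w _); lia.
Qed.

Lemma pal_on_concentric w x y t : pal_on w x y -> x <= t -> t <= x + y - t ->
  pal_on w t (x + y - t).
Proof. by move=> pal le_xt le_t m le_m lt_m; rewrite pal; try lia; congr (w _); lia. Qed.

Definition period_on w p x y := forall m, x <= m -> m + p < y -> w m = w (m + p).

Lemma period_on_sub w p x y a b : period_on w p x y -> x <= a -> b <= y ->
  period_on w p a b.
Proof. by move=> per le_xa le_by m le_m lt_m; apply: per; lia. Qed.

(** Composing the reflections in the centres of two palindromes with a common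
    left end is the translation by the difference of their lengths. *)
Lemma pal_on_period w x e e' : x <= e -> e <= e' ->
  pal_on w x e -> pal_on w x e' -> period_on w (e' - e) x e'.
Proof.
move=> le_xe le_e pal pal' m le_m lt_m.
by rewrite pal 1?[RHS]pal'; try lia; congr (w _); lia.
Qed.

(** Periods as borders: v has period p when deleting its first p letters leaves
    a prefix of v. Every p >= size v is thus a period of v. *)
Definition has_period p v := prefix (drop p v) v.

Lemma has_periodP x0 p v :
  reflect (forall i, i + p < size v -> nth x0 v i = nth x0 v (i + p)) (has_period p v).
Proof.
rewrite /has_period prefixE size_drop; apply: (iffP eqP) => [eq_v i lt_i|eq_v].
  by rewrite -[LHS](@nth_take (size v - p)) ?eq_v ?nth_drop ?[p + i]addnC //; lia.
apply: (@eq_from_nth _ x0); first by rewrite size_takel ?size_drop ?leq_subr.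
rewrite size_takel ?leq_subr // => i lt_i; have lt_ip : i + p < size v by lia.
by rewrite nth_take ?nth_drop 1?[p + i]addnC; [apply: eq_v | lia].
Qed.

Lemma has_period_fac w p x y : x <= y -> has_period p (fac w x y) <-> period_on w p x y.
Proof.
move=> le_xy; split=> [/(has_periodP (w 0)) per m le_m lt_m|per].
  have := per (m - x); rewrite size_fac !nth_fac; try lia.
  by move=> eq_w; rewrite -[m in LHS](subnKC le_m) eq_w; [congr (w _)|]; lia.
apply/(has_periodP (w 0)) => i; rewrite size_fac => lt_i.
by rewrite !nth_fac ?addnA; [apply: per| |]; lia.
Qed.

Lemma has_period_factor p a f c : has_period p (a ++ f ++ c) -> has_period p f.
Proof.
case: f => [|x0 f'] //; set f := x0 :: f' => /(has_periodP x0) per.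
apply/(has_periodP x0) => i lt_i; have := per (size a + i).
rewrite !nth_cat !size_cat.
do ![case: ifP => ?; try lia].
have -> : size a + i - size a = i by lia.
have -> : size a + i + p - size a = i + p by lia.
by apply; lia.
Qed.

Lemma has_period_rev p v : has_period p v -> has_period p (rev v).
Proof.
case: v => [|x0 v'] //; set v := x0 :: v' => /(has_periodP x0) per.
apply/(has_periodP x0) => i; rewrite size_rev => lt_i.
rewrite !nth_rev; try lia.
by rewrite [RHS]per; [congr (nth _ _ _)|]; lia.
Qed.

End Factors.

(** * Fractional powers as periodic words *)
Section Exponents.
Variable A : eqType.
Implicit Types (x v : seq A).

Lemma nth_flatten_nseq (x0 : A) n x i : i < n * size x ->
  nth x0 (flatten (nseq n x)) i = nth x0 x (i %% size x).
Proof.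
elim: n i => [|n IHn] i //=; rewrite nth_cat mulSn => lt_i.
have [lt_ix|le_xi] := ltnP i (size x); first by rewrite modn_small.
rewrite IHn; last lia.
by rewrite -[in RHS](subnKC le_xi) modnDl.
Qed.

Lemma size_flatten_nseq n x : size (flatten (nseq n x)) = n * size x.
Proof. by rewrite size_flatten /shape map_nseq sumn_nseq mulnC. Qed.

Lemma nth_period (x0 : A) p v i : 0 < p -> has_period p v -> i < size v ->
  nth x0 v i = nth x0 v (i %% p).
Proof.
move=> p_gt0 /(has_periodP x0) per; elim/ltn_ind: i => i IHi lt_i.
have [lt_ip|le_pi] := ltnP i p; first by rewrite modn_small.
have -> : nth x0 v i = nth x0 v (i - p) by rewrite [RHS]per subnK.
rewrite IHi; try lia.
by rewrite -{2}(subnK le_pi) modnDr.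
Qed.

(** A fractional power x^(p/q) is a word of length (p/q)|x| with period |x|;
    conversely a word v of period p is the power of exponent |v|/p of its prefix
    of length p. *)
Lemma is_power_geP k v : 0 < k ->
  is_power_ge k v <-> exists p, [/\ 0 < p, k * p <= size v & has_period p v].
Proof.
move=> k_gt0; split=> [[r [le_kr [x [p [q [x_neq0 q_gt0 def_r dv_q def_v]]]]]]|].
  have x_gt0 : 0 < size x by rewrite lt0n size_eq0.
  have le_kq : k * q <= p.
    move: le_kr; rewrite def_r Num.Theory.ler_pdivlMr ?Num.Theory.ltr0n //.
    by rewrite -GRing.natrM Num.Theory.ler_nat.
  have [c def_x] := dvdnP dv_q.
  have size_v : size v = p * c.
    rewrite def_v size_cat size_flatten_nseq size_takel; rewrite def_x mulnK //.
      by rewrite mulnA mulnAC -mulnDl -divn_eq.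
    by rewrite mulnC leq_mul2l (ltnW (ltn_pmod _ _)) ?orbT.
  exists (size x); split=> //; first by rewrite size_v def_x; nia.
  case: x x_neq0 {x_gt0 dv_q} def_v def_x size_v => // x0 x' _; set x := x0 :: x'.
  move=> def_v def_x size_v.
  have nth_v i : i < size v -> nth x0 v i = nth x0 x (i %% size x).
    rewrite size_v => lt_i; rewrite def_v nth_cat size_flatten_nseq.
    have [lt_iq|le_qi] := ltnP; first by rewrite nth_flatten_nseq.
    rewrite nth_take.
      rewrite -[in RHS](subnKC le_qi) modnMDl modn_small //.
      have : p %% q < q by rewrite ltn_pmod.
      have : p = p %/ q * q + p %% q by apply: divn_eq.
      by move: le_qi lt_i; rewrite def_x; nia.
    have : p = p %/ q * q + p %% q by apply: divn_eq.
    by move: le_qi lt_i; rewrite def_x mulnK //; nia.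
  by apply/(has_periodP x0) => i lt_i; rewrite !nth_v ?modnDr //; lia.
case=> p [p_gt0 le_kp per].
have le_pv : p <= size v by nia.
case: v le_kp per le_pv => [|x0 v']; first by rewrite /=; lia.
set v := x0 :: v' => le_kp per le_pv.
have size_x : size (take p v) = p by rewrite size_takel.
exists ((size v)%:R / p%:R)%R; split.
  by rewrite Num.Theory.ler_pdivlMr ?Num.Theory.ltr0n // -GRing.natrM Num.Theory.ler_nat.
exists (take p v), (size v), p; split; rewrite ?size_x //.
  by rewrite -size_eq0 size_x -lt0n.
rewrite /frac_power size_x divnn p_gt0 muln1 take_takel ?(ltnW (ltn_pmod _ _)) //.
have size_r : size (take (size v %% p) v) = size v %% p.
  by rewrite size_takel // leq_mod.
apply: (@eq_from_nth _ x0).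
  by rewrite size_cat size_flatten_nseq size_r size_x -divn_eq.
move=> i lt_i; rewrite nth_cat size_flatten_nseq size_x (nth_period _ p_gt0) //.
have [lt_iq|le_qi] := ltnP.
  by rewrite nth_flatten_nseq size_x // nth_take // ltn_pmod.
have := divn_eq (size v) p; have := ltn_pmod (size v) p_gt0 => lt_m def_v.
rewrite nth_take; last lia.
by rewrite -[in LHS](subnKC le_qi) modnMDl modn_small //; lia.
Qed.

End Exponents.

(** * Products of blocks *)
Section Blocks.
Variable A : eqType.
Implicit Types (w : nat -> A) (u v : seq A) (B : seq A -> Prop).

Lemma equidivisible u v a b : u ++ v = a ++ b ->
  (exists c, u = a ++ c /\ b = c ++ v) \/ (exists c, a = u ++ c /\ v = c ++ b).
Proof.
elim: u a => [|x u IHu] [|y a] /=; first by right; exists [::].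
- by right; exists (y :: a).
- by move=> <-; left; exists (x :: u).
case=> <- /IHu[] [c [-> ->]]; [left | right]; by exists c.
Qed.

Record block_family B : Prop := BlockFamily {
  block_nil : B [::];
  block_letter : forall a, B [:: a];
  block_factor : forall u v x, B (u ++ v ++ x) -> B v;
  block_rev : forall v, B v -> B (rev v) }.

(** As the empty word belongs to every block family, products of exactly n blocks are the same as
    products of at most n blocks. *)
Fixpoint splits B n u : Prop :=
  if n is n'.+1 then exists a b, [/\ u = a ++ b, B a & splits B n' b] else u = [::].

Variable B : seq A -> Prop.
Hypothesis Bfam : block_family B.

Lemma splits1 v : splits B 1 v <-> B v.
Proof.
split=> [[a [b [-> Ba ->]]]|Bv]; first by rewrite cats0.
by exists v, [::]; rewrite cats0.
Qed.

Lemma splits_nil n : splits B n [::].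
Proof. by elim: n => //= n IHn; exists [::], [::]; split=> //; apply: block_nil Bfam. Qed.

Lemma splits_cat n m u v : splits B n u -> splits B m v -> splits B (n + m) (u ++ v).
Proof.
elim: n u => [|n IHn] u /=; first by move=> ->.
case=> a [b [-> Ba sb]] sv; exists a, (b ++ v).
by rewrite catA; split=> //; apply: IHn.
Qed.

Lemma splits_leq n m u : n <= m -> splits B n u -> splits B m u.
Proof.
move=> le_nm su; rewrite -(subnKC le_nm) -[u]cats0.
by apply: splits_cat => //; apply: splits_nil.
Qed.

Lemma splits_size u : splits B (size u) u.
Proof.
elim: u => //= a u IHu; exists [:: a], u; split=> //; exact: block_letter Bfam _.
Qed.

Lemma splits_factor n u v x : splits B n (u ++ v ++ x) -> splits B n v.
Proof.
suff drop_left m y z : splits B m (y ++ z) -> splits B m z.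
  move/drop_left; elim: n v {u} => [|n IHn] v /=; first by case: v.
  case=> a [b [/equidivisible[] [c [def_v def_b]] Ba sb]].
    by exists a, c; split=> //; apply: IHn; rewrite -def_b.
  exists v, [::]; rewrite cats0; split; [by []| |exact: splits_nil].
  by apply: (@block_factor _ Bfam [::] _ c); rewrite /= -def_v.
elim: m y z => [|m IHm] y z /=; first by case: y.
case=> a [b [/equidivisible[] [c [def_y def_z]] Ba sb]].
  by apply: (splits_leq (leqnSn m)); apply: (IHm c); rewrite -def_z.
exists c, b; split=> //.
by apply: (@block_factor _ Bfam y _ [::]); rewrite cats0 -def_y.
Qed.

(** Superadditivity of the measure, up to 1: if u needs more than n blocks and v
    more than m, then u ++ v needs more than n + m. In a decomposition of
    u ++ v only the block that straddles the border is used on both sides, and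
    it has to be counted on one side only. *)
Lemma splits_catV n m u v : splits B (n + m) (u ++ v) -> splits B n u \/ splits B m v.
Proof.
elim: n u => [|n IHn] u; first by rewrite -[u ++ v]cats0 -catA => /splits_factor; right.
case=> a [b [/equidivisible[] [c [def_u def_b]] Ba sb]].
  rewrite def_b in sb; case: (IHn _ sb) => [sc|]; last by right.
  by left; exists a, c.
left; exists u, [::]; rewrite cats0; split; [by []| |exact: splits_nil].
by apply: (@block_factor _ Bfam [::] _ c); rewrite /= -def_u.
Qed.

Lemma splits_rev n u : splits B n u -> splits B n (rev u).
Proof.
elim: n u => [|n IHn] u; first by move=> /= ->.
case=> a [b [-> Ba sb]]; rewrite rev_cat -addn1; apply: splits_cat; first exact: IHn.
by apply/splits1; apply: block_rev Bfam _ Ba.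
Qed.

Lemma splits_fac_sub n w x y a b : x <= a -> a <= b -> b <= y ->
  splits B n (fac w x y) -> splits B n (fac w a b).
Proof. by move=> le_xa le_ab le_by; rewrite (fac_cat3 w le_xa le_ab le_by); apply: splits_factor. Qed.

Lemma splits_fac_cat n m w x y z : x <= y -> y <= z ->
  splits B n (fac w x y) -> splits B m (fac w y z) -> splits B (n + m) (fac w x z).
Proof. by move=> le_xy le_yz; rewrite (fac_cat w le_xy le_yz); apply: splits_cat. Qed.

Lemma longest_split n w e j : e <= j -> exists2 y, e <= y <= j &
  splits B n (fac w e y) /\ forall y', e <= y' <= j -> splits B n (fac w e y') -> y' <= y.
Proof.
move=> le_ej.
pose Q y := (e <= y <= j) && `[< splits B n (fac w e y) >].
have exQ : exists y, Q y.
  by exists e; rewrite /Q leqnn le_ej; apply/asboolP; rewrite fac_nil; apply: splits_nil.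
have ubQ y : Q y -> y <= j by case/andP=> /andP[].
case: (ex_maxnP exQ ubQ) => y /andP[le_y /asboolP sy] max_y.
exists y => //; split=> // y' le_y' sy'; apply: max_y.
by rewrite /Q le_y'; apply/asboolP.
Qed.

End Blocks.

Arguments splits {A} B n u : simpl never.

(** * Positions reached by products of palindromes *)
Section Reach.
Variables (A : eqType) (w : nat -> A) (k : nat) (B : seq A -> Prop).
Variables (i j : nat).
Hypothesis Bfam : block_family B.
Hypothesis k_gt0 : 0 < k.
Hypothesis powB : forall p x y, 0 < p -> i <= x -> y <= j -> k * p <= y - x ->
  period_on w p x y -> B (fac w x y).

Definition sporadic t e := [/\ t <= e <= j, pal_on w t e & ~ B (fac w t e)].

(** The longer palindrome has period e' - e and is not a block, so its exponent
    is smaller than k: this is e' - t < k (e' - e). *)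
Lemma sporadic_growth t e e' : i <= t -> sporadic t e -> sporadic t e' -> e < e' ->
  (e' - t) + k * (e - t) < k * (e' - t).
Proof.
move=> le_it [/andP[le_te le_ej] pal_e _] [/andP[le_te' le_ej'] pal_e' nB] lt_e.
suff : e' - t < k * (e' - e).
  have -> : k * (e' - t) = k * (e' - e) + k * (e - t) by rewrite -mulnDr; congr (_ * _); lia.
  lia.
rewrite ltnNge; apply/negP => le_k; apply: nB.
apply: (@powB (e' - e)); rewrite ?subn_gt0 //; exact: pal_on_period (ltnW _) _ _.
Qed.

Definition sporadic_ends t := [seq e <- index_iota t j.+1 | `[< sporadic t e >]].

Lemma sporadic_endsP t e : reflect (sporadic t e) (e \in sporadic_ends t).
Proof.
rewrite mem_filter mem_index_iota ltnS.
apply: (iffP andP) => [[/asboolP]//|spor_e].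
by split; [apply/asboolP | case: spor_e].
Qed.

Lemma sporadic_ends_sorted t : sorted ltn (sporadic_ends t).
Proof. exact/sorted_filter/iota_ltn_sorted/ltn_trans. Qed.

(** Not being a block means measure at least 2, and every k-th step in the list
    of these palindromes doubles the measure minus one: the length doubles, so
    the palindrome of step k (m + 1) starts with the one of step k m and, being
    equal to its reversal, also ends with a disjoint copy of it. *)
Lemma size_sporadic t n : i <= t -> splits B (2 ^ n) (fac w i j) ->
  size (sporadic_ends t) <= k * n.
Proof.
move=> le_it sw; rewrite leqNgt; apply/negP => lt_n.
set E := sporadic_ends t in lt_n.
pose e x := nth 0 E x.
have spor_e x : x < size E -> sporadic t (e x).
  by move=> lt_x; apply/sporadic_endsP; apply: mem_nth.
have lt_e x y : x < y -> y < size E -> e x < e y.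
  move=> lt_xy lt_y; apply: (sorted_ltn_nth ltn_trans) => //; last exact: ltn_trans lt_y.
  exact: sporadic_ends_sorted.
(* From a length a to the next length a' the increment is at least a' / k,
   hence at least 1 / k times the initial length; it is added y times. *)
have grow x y : x + y < size E -> (k + y) * (e x - t) <= k * (e (x + y) - t).
  elim: y => [|y IHy] lt_y; first by rewrite !addn0.
  have lt_y' : x + y < size E by lia.
  have lt_x : x < size E by lia.
  have := sporadic_growth le_it (spor_e _ lt_y') (spor_e _ lt_y).
  have ? : e x <= e (x + y).
    by case: (y) lt_y' => [|y'] lt_y'; rewrite ?addn0 // ltnW // lt_e //; lia.
  have lt_ee : e (x + y) < e (x + y.+1) by apply: lt_e => //; lia.
  move/(_ lt_ee).
  have := IHy lt_y'; lia.
suff nsplit m : k * m < size E -> ~ splits B (2 ^ m) (fac w t (e (k * m))).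
  apply: (nsplit n lt_n); have [/andP[le_te le_ej] _ _] := spor_e _ lt_n.
  exact: splits_fac_sub sw.
elim: m => [|m IHm] lt_m.
  by rewrite splits1; case: (spor_e _ lt_m).
have lt_m' : k * m < size E by lia.
have := grow (k * m) k; rewrite addnC -mulnS => /(_ lt_m).
set a := e (k * m); set b := e (k * m.+1) => le_ab.
have [/andP[le_ta le_aj] pal_a _] := spor_e _ lt_m'; rewrite -/a in le_ta le_aj pal_a.
have [/andP[le_tb le_bj] pal_b nB] := spor_e _ lt_m; rewrite -/b in le_tb le_bj pal_b nB.
have {}le_ab : a <= t + b - a by nia.
rewrite expnS mul2n -addnn => sab.
have le_tba : t + b - a <= b by lia.
rewrite (fac_cat w (leq_trans le_ta le_ab) le_tba) in sab.
have [|] := splits_catV Bfam sab; first by move/splits_fac_sub=> s; apply: IHm lt_m' _; apply: s.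
have le_a_b : a <= b by lia.
have := pal_on_rev pal_b (leqnn t) le_ta le_a_b; rewrite addKn => ->.
by move/(splits_rev Bfam); rewrite revK; apply: IHm.
Qed.

Definition covered (Is : seq (nat * nat)) y := exists2 I, I \in Is & I.1 <= y <= I.2.

Definition block_cover K (Is : seq (nat * nat)) :=
  forall I, I \in Is -> [/\ i <= I.1, I.1 <= I.2, I.2 <= j & splits B K (fac w I.1 I.2)].

(** Let a palindrome start in [s, t] and end at y > t. If its centre is at most
    t, reflection maps [t, y] into [s, t], so [t, y] has measure at most K. If
    its centre is to the right of t, shrink the palindrome around its centre
    until it starts at t, and let e be the end of the shrunk palindrome; then
    [e, y] is a reflected part of [s, t] and has measure at most K. The shrunk
    palindrome is either a block, and then [t, y] has measure at most K + 1, or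
    one of the O(log) sporadic palindromes at t. So y lies either in the
    longest interval of measure at most K + 1 starting at t, which is glued to
    [s, t], or in the longest interval of measure at most K starting at e. *)
Lemma reach_interval K n s t : splits B (2 ^ n) (fac w i j) ->
  i <= s -> s <= t -> t <= j -> splits B K (fac w s t) ->
  exists Is, [/\ size Is <= k * n + 1, block_cover K.*2.+1 Is &
    forall x y, s <= x <= t -> x <= y <= j -> pal_on w x y -> covered Is y].
Proof.
move=> sw le_is le_st le_tj sI.
have [t' /andP[le_tt' le_t'j] [st' max_t']] := longest_split Bfam K.+1 w le_tj.
have ext e : exists y, e <= j -> [/\ e <= y, y <= j, splits B K (fac w e y) &
    forall y', e <= y' <= j -> splits B K (fac w e y') -> y' <= y].
  have [le_ej|?] := leqP e j; last by exists 0.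
  have [y /andP[? ?] [? ?]] := longest_split Bfam K w le_ej.
  by exists y.
have [far farP] := choice ext.
exists ((s, t') :: [seq (e, far e) | e <- sporadic_ends t]); split.
- rewrite /= size_map addn1 ltnS; apply: size_sporadic sw; exact: leq_trans le_st.
- move=> I; rewrite inE => /predU1P[-> /=|/mapP[e /sporadic_endsP[/andP[le_te le_ej] _ _] -> /=]].
    split=> //; first exact: leq_trans le_tt'.
    have -> : K.*2.+1 = K + K.+1 by lia.
    exact: (splits_fac_cat le_st le_tt' sI st').
  have [? ? sfar _] := farP e le_ej; split=> //; first lia.
  by apply: splits_leq sfar => //; lia.
move=> x y /andP[le_sx le_xt] /andP[le_xy le_yj] pal.
have in_first : y <= t' -> covered ((s, t') :: [seq (e, far e) | e <- sporadic_ends t]) y.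
  by move=> le_y; exists (s, t'); rewrite ?mem_head //=; lia.
have [le_yt|lt_ty] := leqP y t; first by apply: in_first; lia.
(* x + y is twice the centre. *)
have [le_center|lt_center] := leqP (x + y) (t + t).
  apply/in_first/max_t'; first lia.
  apply: (@splits_leq _ _ Bfam K); first lia.
  have le1 : x <= x + y - t by lia.
  have le2 : x + y - t <= y by lia.
  have := pal_on_rev pal (leqnn x) le1 le2; rewrite addKn.
  have -> : x + y - (x + y - t) = t by lia.
  by move=> ->; apply: splits_rev Bfam _ _ _; apply: splits_fac_sub sI => //; lia.
pose e := x + y - t.
have s_ey : splits B K (fac w e y).
  have := pal_on_rev pal (leqnn x) le_xt (ltnW lt_ty); rewrite addKn => ->.
  by apply: splits_rev Bfam _ _ _; apply: splits_fac_sub sI => //; lia.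
have lt_te : t < e by rewrite /e; lia.
have le_ey : e <= y by rewrite /e; lia.
have [B_te|nB_te] := pselect (B (fac w t e)).
  apply/in_first/max_t'; first lia.
  rewrite -add1n; apply: splits_fac_cat (s_ey) => //; first lia.
  by apply/splits1.
have spor_e : sporadic t e.
  split=> //; first lia.
  apply: pal_on_concentric pal le_xt _; lia.
have [le_efar _ _ max_far] := farP e (leq_trans le_ey le_yj).
exists (e, far e); first by rewrite inE map_f ?orbT //; apply/sporadic_endsP.
by rewrite /= le_ey max_far // le_ey.
Qed.

Lemma reach_step K n Is : splits B (2 ^ n) (fac w i j) -> block_cover K Is ->
  exists Is', [/\ size Is' <= (k * n + 1) * size Is, block_cover K.*2.+1 Is' &
    forall x y, covered Is x -> x <= y <= j -> pal_on w x y -> covered Is' y].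
Proof.
move=> sw; elim: Is => [|[s t] Is IHIs] okIs.
  by exists [::]; split=> // x y [].
have [|Is1 [sz1 ok1 cov1]] := IHIs; first by move=> I I_in; apply: okIs; rewrite inE I_in orbT.
have [/= le_is le_st le_tj sI] := okIs _ (mem_head _ _).
have [Is2 [sz2 ok2 cov2]] := reach_interval sw le_is le_st le_tj sI.
exists (Is2 ++ Is1); split.
- by rewrite size_cat mulnS leq_add.
- by move=> I; rewrite mem_cat => /orP[/ok2|/ok1].
move=> x y [I]; rewrite inE => /predU1P[-> /=|I_in] x_in le_xy pal.
  have [I' I'_in y_in] := cov2 x y x_in le_xy pal.
  by exists I' => //; rewrite mem_cat I'_in.
have [I' I'_in y_in] := cov1 x y (ex_intro2 _ _ I I_in x_in) le_xy pal.
by exists I' => //; rewrite mem_cat I'_in orbT.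
Qed.

(** The measure bounds K_P of the intervals satisfy K_0 = 0 and
    K_(P+1) = 2 K_P + 1, whence 2^P - 1. *)
Lemma reach_factorizations n P : i <= j -> splits B (2 ^ n) (fac w i j) ->
  exists Is, [/\ size Is <= (k * n + 1) ^ P, block_cover (2 ^ P).-1 Is &
    forall y, i <= y <= j -> pal_factorization (fac w i y) P -> covered Is y].
Proof.
move=> le_ij sw; elim: P => [|P [Is [szI okI covI]]].
  exists [:: (i, i)]; split=> // [I|y /andP[le_iy le_yj] [vs [/size0nil-> _ /= y_nil]]].
    by rewrite inE => /eqP-> /=; split; rewrite ?fac_nil //.
  have := congr1 size y_nil; rewrite size_fac /= => ?.
  by exists (i, i); rewrite ?mem_head //=; lia.
have [Is' [szI' okI' covI']] := reach_step sw okI.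
exists Is'; split.
- by apply: leq_trans szI' _; rewrite expnS leq_mul.
- have -> : (2 ^ P.+1).-1 = (2 ^ P).-1.*2.+1 by have := expn_gt0 2 P; rewrite expnS; lia.
  by [].
move=> y /andP[le_iy le_yj] [vs [sz_vs pals def_y]].
case/lastP: vs sz_vs pals def_y => [|vs v] //; rewrite size_rcons => -[sz_vs].
rewrite all_rcons flatten_rcons => /andP[pal_v pals] def_y.
have [le_z def_vs def_v] := fac_eq_cat le_iy def_y.
set z := i + _ in le_z def_vs def_v.
apply: (covI' z); rewrite ?le_z //.
  apply: covI; first by rewrite leq_addr /=; lia.
  by exists vs.
by apply: palindrome_fac => //; rewrite -def_v.
Qed.

(** Walk from left to right: an interval that covers the current position x
    accounts for K blocks up to its right end t, and the letter at t for one
    more; from t + 1 on that interval is useless and can be discarded. *)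
Lemma covered_splits K N Is x : size Is <= N -> block_cover K Is -> i <= x -> x <= j ->
  (forall y, x <= y <= j -> covered Is y) -> splits B (N * K.+1) (fac w x j).
Proof.
elim: N Is x => [|N IHN] Is x szI okI le_ix le_xj cov.
  have [|I] := cov x; first by rewrite leqnn.
  by move: szI; rewrite leqn0 => /nilP->.
have [|[s t] I_in /= /andP[le_sx le_xt]] := cov x; first by rewrite leqnn.
have [/= le_is le_st le_tj sI] := okI _ I_in.
have sxt : splits B K (fac w x t) by apply: splits_fac_sub sI.
rewrite mulSn; have [le_jt|lt_tj] := leqP j t.
  have <- : t = j by lia.
  by apply: splits_leq sxt => //; lia.
apply: (splits_fac_cat (y := t.+1)) => //; first lia.
  rewrite -addn1; apply: splits_fac_cat sxt _ => //.
  by apply/splits1; rewrite /fac subSnn; apply: block_letter Bfam _.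
apply: (IHN (rem (s, t) Is)) => //; last move=> y /andP[lt_ty le_yj].
- by rewrite size_rem //; move: szI; case: (size Is).
- by move=> I /mem_rem; apply: okI.
- lia.
have [|I I_in' y_in] := cov y; first lia.
exists I => //.
have neq : I != (s, t) by apply/eqP => def_I; move: y_in; rewrite def_I /=; lia.
have := perm_mem (perm_to_rem I_in) I; rewrite I_in' inE (negPf neq) //=.
Qed.

Lemma splits_of_short_prefixes n P : i <= j -> splits B (2 ^ n) (fac w i j) ->
  (forall y, i <= y <= j -> pal_length (fac w i y) <= P) ->
  splits B ((k * n + 1) ^ P * 2 ^ P) (fac w i j).
Proof.
move=> le_ij sw short.
have [Is [szI okI covI]] := reach_factorizations P le_ij sw.
have -> : 2 ^ P = (2 ^ P).-1.+1 by rewrite prednK ?expn_gt0.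
apply: covered_splits szI okI _ _ _ => // y le_y; apply: covI => //.
have := short y le_y; rewrite /pal_length; case: ex_minnP => n0 /asboolP[vs [sz_vs pals def_y]] _ le_nP.
(* Empty palindromes pad a factorization to exactly P factors. *)
exists (vs ++ nseq (P - n0) [::]); split.
- by rewrite size_cat size_nseq sz_vs subnKC.
- by rewrite all_cat pals all_nseq orbT.
rewrite flatten_cat def_y; suff -> : flatten (nseq (P - n0) ([::] : seq A)) = [::] by rewrite cats0.
by elim: (P - n0).
Qed.

End Reach.

(** Since n + 1 <= 2P * 2^(n/(2P)), the left-hand side is at most
    (2Pc)^P * 2^(n/2), and (2Pc)^P <= 2^(n/2) for large n. *)
Lemma exp_beats_poly c P : exists n0, forall n, n0 <= n -> (c * n.+1) ^ P <= 2 ^ n.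
Proof.
have [->|P_gt0] := posnP P; first by exists 0 => n _; rewrite expn0 expn_gt0.
have [d def_d] : exists d, d = 2 * P * c by eexists.
exists (2 * d ^ P) => n le_n.
set q := n %/ (2 * P).
have le_n1 : n.+1 <= 2 * P * 2 ^ q.
  apply: leq_trans (_ : 2 * P * q.+1 <= _); last by rewrite leq_mul2l ltn_expl ?orbT.
  by rewrite mulnC ltn_ceil //; lia.
apply: leq_trans (_ : (d * 2 ^ q) ^ P <= _).
  rewrite leq_exp2r // def_d; apply: leq_trans (_ : c * (2 * P * 2 ^ q) <= _).
    by rewrite leq_mul2l le_n1 orbT.
  by lia.
rewrite expnMn -expnM; apply: leq_trans (_ : 2 ^ n./2 * 2 ^ n./2 <= _).
  apply: leq_mul.
    apply: leq_trans (ltnW (ltn_expl _ (ltnSn 1))) _.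
    by rewrite leq_exp2l //; lia.
  rewrite leq_exp2l //; have := leq_divM n (2 * P); rewrite -/q; lia.
by rewrite -expnD leq_exp2l //; lia.
Qed.

(** By [splits_of_short_prefixes], a splitting into 2^(n+1) blocks can be
    improved to (k (n + 1) + 1)^P 2^P blocks, which is at most 2^n as long as n
    is large. Descending on n yields a bound that depends on k and P only; the
    interval [i, j) can thus be chosen after the bound. *)
Theorem few_blocks k P : 0 < k -> exists M, forall (A : eqType) (w : nat -> A) B i j,
  block_family B -> i <= j ->
  (forall p x y, 0 < p -> i <= x -> y <= j -> k * p <= y - x ->
     period_on w p x y -> B (fac w x y)) ->
  (forall y, i <= y <= j -> pal_length (fac w i y) <= P) ->
  splits B M (fac w i j).
Proof.
move=> k_gt0; have [n0 n0P] := exp_beats_poly (2 * (k + 1)) P.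
exists (2 ^ n0) => A w B i j Bfam le_ij powB short.
have [n] : exists n, splits B (2 ^ n) (fac w i j).
  exists (size (fac w i j)); apply: (splits_leq Bfam) (splits_size Bfam _).
  exact: ltnW (ltn_expl _ _).
elim: n => [|n IHn] sw.
  by apply: splits_leq sw => //; rewrite leq_exp2l.
have [le_n|lt_n] := leqP n0 n; last by apply: splits_leq sw => //; rewrite leq_exp2l.
apply: IHn; have := splits_of_short_prefixes Bfam k_gt0 powB le_ij sw short.
apply: splits_leq => //; apply: leq_trans (n0P n le_n).
rewrite -expnMn; case: (P) => [|P'] //; rewrite leq_exp2r //; nia.
Qed.

(** * Periodic words as larger blocks *)
Section PeriodicBlocks.
Variable A : eqType.
Implicit Types (w : nat -> A) (B : seq A -> Prop).

(** The condition bears on all factors of length at most p, and not only on the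
    prefix of length p, to make the family closed under factors. *)
Definition periodic_blocks B M (v : seq A) : Prop := exists p,
  [/\ 0 < p, has_period p v &
      forall x u y, v = x ++ u ++ y -> size u <= p -> splits B M u].

Lemma periodic_blocks_family B M :
  block_family B -> 0 < M -> block_family (periodic_blocks B M).
Proof.
move=> Bfam M_gt0; split.
- exists 1; split=> // x u y /(congr1 size) /=; rewrite !size_cat => sz _.
  have /size0nil -> : size u = 0 by lia.
  exact: splits_nil.
- move=> a; exists 1; split=> // x u y _ le_u.
  by apply: splits_leq (splits_size Bfam u) => //; apply: leq_trans M_gt0.
- move=> u v x [p [p_gt0 per short]]; exists p; split=> //; first exact: has_period_factor per.
  move=> y t z def_v; apply: (short (u ++ y) t (z ++ x)).
  by rewrite def_v !catA.
move=> v [p [p_gt0 per short]]; exists p; split=> //; first exact: has_period_rev.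
move=> x u y def_v le_u; rewrite -[u]revK; apply: splits_rev => //.
apply: (short (rev y) _ (rev x)); last by rewrite size_rev.
by rewrite -[v]revK def_v !rev_cat catA.
Qed.

Lemma period_on_mul w p c x y : period_on w p x y -> period_on w (c * p) x y.
Proof.
move=> per; elim: c => [|c IHc] m le_m lt_m; first by rewrite addn0.
rewrite mulSn in lt_m *; rewrite addnA -IHc; [apply: per => //| |]; lia.
Qed.

Definition unsplittable w B := forall M, exists y, ~ splits B M (fac w 0 y).

(** If prefixes of w were products of boundedly many periodic blocks, then from
    some position s on all factors starting at s would be single blocks. Some
    factor starting at s is not a product of M old blocks; its length bounds the
    periods of all longer blocks. The factorial of this length is then a period
    common to all of them, and w is ultimately periodic. *)
Lemma unsplittable_periodic w B M : ~ ultimately_periodic w -> block_family B ->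
  0 < M -> unsplittable w B -> unsplittable w (periodic_blocks B M).
Proof.
move=> aper Bfam M_gt0 unsB; pose B' := periodic_blocks B M.
have B'fam : block_family B' by apply: periodic_blocks_family.
(* Cutting w at positions s with non-blocks in between, the measure of the
   prefixes grows at every cut. *)
suff next s : exists2 t, s <= t & ~ B' (fac w s t).
  elim=> [|N [y nsy]]; first by exists 1.
  have [t le_yt nB't] := next y; exists t.
  rewrite (fac_cat w (leq0n y) le_yt) -addn1 => /(splits_catV B'fam)[] //.
  by rewrite splits1.
apply: contrapT => all_blocks.
have {}all_blocks t : s <= t -> B' (fac w s t).
  by move=> le_st; apply: contrapT => nB'; apply: all_blocks; exists t.
have [y0 ns0] := unsB (s + M).
have [le_ys|lt_sy] := leqP y0 s.
  apply: ns0; apply: splits_leq (splits_size Bfam _) => //.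
  by rewrite size_fac; lia.
have ns : ~ splits B M (fac w s y0).
  move=> sp; apply: ns0; apply: splits_fac_cat sp => //; first exact: ltnW.
  by apply: splits_leq (splits_size Bfam _) => //; rewrite size_fac subn0.
apply: aper; exists s, (y0 - s)`!; split; first exact: fact_gt0.
move=> m le_sm.
pose t := maxn y0 (m + (y0 - s)`!).+1.
have le_y0t : y0 <= t by apply: leq_maxl.
have le_st : s <= t by apply: leq_trans (ltnW lt_sy) _.
have [p [p_gt0 per short]] := all_blocks t le_st.
have lt_p : p < y0 - s.
  rewrite ltnNge; apply/negP => le_p; apply: ns.
  apply: (short [::] _ (fac w y0 t)); last by rewrite size_fac.
  by rewrite /= -fac_cat // ltnW.
have /dvdnP[c def_fact] : p %| (y0 - s)`! by apply: dvdn_fact; rewrite p_gt0 ltnW.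
have /period_on_mul per_fact : period_on w p s t by apply/has_period_fac.
by rewrite def_fact -per_fact // -def_fact leq_maxr.
Qed.

End PeriodicBlocks.

(** * Nested powers and runs *)
Section Towers.
Variables (A : eqType) (w : nat -> A) (k : nat).
Hypothesis k_gt1 : 1 < k.
Hypothesis aperiodic : ~ ultimately_periodic w.

Definition power_on p x y := [/\ 0 < p, k * p <= y - x & period_on w p x y].

(** Nested powers within [x, y): the next power lies in a factor [a', b') that
    is no longer than the minimal period of the current power [a, b), so that
    its own minimal period is strictly smaller. *)
Fixpoint tower d x y : Prop :=
  if d is d'.+1 then
    exists a b p a' b',
      [/\ x <= a, b <= y, power_on p a b,
          (forall q, 0 < q -> period_on w q a b -> p <= q) &
          [/\ a <= a', a' < b', b' <= b, b' - a' <= p & tower d' a' b']]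
  else True.

Lemma tower_sub d x y x' y' : x' <= x -> y <= y' -> tower d x y -> tower d x' y'.
Proof.
case: d => // d le_x le_y [a [b [p [a' [b' [le_xa le_by pow min nest]]]]]].
by exists a, b, p, a', b'; split=> //; lia.
Qed.

Definition powers_tower d (B : seq A -> Prop) :=
  forall p x y, power_on p x y -> ~ B (fac w x y) -> tower d x y.

(** A power that is not a periodic block has, for its minimal period p, a factor
    of length at most p that is not a product of M blocks, and this factor
    contains a power of the previous level. *)
Lemma powers_tower_step d (B : seq A -> Prop) M :
  (forall x y, x <= y -> ~ splits B M (fac w x y) ->
     exists p a b, [/\ x <= a, b <= y, power_on p a b & ~ B (fac w a b)]) ->
  powers_tower d B -> powers_tower d.+1 (periodic_blocks B M).
Proof.
move=> dense towB p0 x y [p0_gt0 le_p0 per0] nB'.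
have le_xy : x <= y by nia.
pose Q p := (0 < p) && `[< period_on w p x y >].
have exQ : exists p, Q p by exists p0; rewrite /Q p0_gt0; apply/asboolP.
case: (ex_minnP exQ) => p /andP[p_gt0 /asboolP per] min_p.
(* For the smaller period p the exponent is larger still. *)
have le_pp0 : p <= p0 by apply: min_p; rewrite /Q p0_gt0; apply/asboolP.
have [a' [b' [le_xa le_ab le_by le_p ns]]] : exists a' b',
    [/\ x <= a', a' <= b', b' <= y, b' - a' <= p & ~ splits B M (fac w a' b')].
  apply: contrapT => no_factor; apply: nB'; exists p; split=> //.
    exact/has_period_fac.
  move=> u v z def_uvz le_v; apply: contrapT => nsv; apply: no_factor.
  have [le_xu _ def_vz] := fac_eq_cat le_xy def_uvz.
  have [le_v' def_v _] := fac_eq_cat le_xu (esym def_vz).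
  exists (x + size u), (x + size u + size v); split; rewrite ?leq_addr -?def_v //.
  by rewrite addKn.
have [q [a [b [le_a le_b pow_q nBab]]]] := dense a' b' le_ab ns.
have tow : tower d a' b' by apply: tower_sub (towB _ _ _ pow_q nBab).
have lt_ab : a' < b' by case: pow_q; nia.
exists x, y, p, a', b'; split=> //.
  by split=> //; apply: leq_trans le_p0; rewrite leq_mul2l le_pp0 orbT.
by move=> r r_gt0 per_r; apply: min_p; rewrite /Q r_gt0; apply/asboolP.
Qed.

(** By [few_blocks], a rich family forces the palindromic lengths of the factors
    of w to be unbounded. *)
Definition rich (B : seq A -> Prop) := forall M, exists x y,
  [/\ x <= y, ~ splits B M (fac w x y) &
      forall p a b, x <= a -> b <= y -> power_on p a b -> B (fac w a b)].

Lemma rich_or_tower d : exists2 B, block_family B &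
  rich B \/ unsplittable w B /\ powers_tower d B.
Proof.
elim: d => [|d [B Bfam [richB|[unsB towB]]]]; last 2 first.
- by exists B => //; left.
- have [richB|/existsNP[M poorM]] := pselect (rich B); first by exists B => //; left.
  exists (periodic_blocks B M.+1); first exact: periodic_blocks_family.
  right; split; first exact: unsplittable_periodic.
  apply: powers_tower_step => // x y le_xy ns; apply: contrapT => no_power.
  apply: poorM; exists x, y; split=> //.
    by move=> sM; apply: ns; apply: splits_leq sM.
  move=> p a b le_xa le_by pow; apply: contrapT => nB.
  by apply: no_power; exists p, a, b.
exists (fun v => size v <= 1).
  split=> // [u v x|v]; last by rewrite size_rev.
  by rewrite !size_cat; lia.
right; split=> // M; exists M.+1.
suff sz n u : splits (fun v : seq A => size v <= 1) n u -> size u <= n.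
  by move/sz; rewrite size_fac subn0 ltnn.
elim: n u => [|n IHn] u; first by rewrite /splits => ->.
by case=> a [b [-> sz_a /IHn sz_b]]; rewrite size_cat; lia.
Qed.

Lemma is_power_ge_fac i j : i <= j -> is_power_ge k (fac w i j) <-> exists p, power_on p i j.
Proof.
move=> le_ij; rewrite is_power_geP; last exact: ltnW.
rewrite size_fac.
by split=> -[p [p_gt0 le_p per]]; exists p; split=> //; apply/(has_period_fac w p le_ij).
Qed.

(** Going from a and a + p to the right by q, and from a + q by p, leads to the
    same position a + p + q, which is still inside the word. This is why a power
    of exponent at least 2 can be prolonged by one letter to another such power
    only if its period persists. *)
Lemma period_on_extend_left p q a b : period_on w p a.+1 b -> period_on w q a b ->
  0 < q -> p + q < b - a -> period_on w p a b.
Proof.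
move=> per_p per_q q_gt0 le_pq m; rewrite leq_eqVlt => /predU1P[<- _|]; last exact: per_p.
have -> : w a = w (a + q) by apply: per_q; lia.
have -> : w (a + p) = w (a + p + q) by apply: per_q; lia.
by rewrite per_p; [congr (w _)| |]; lia.
Qed.

Lemma period_on_extend_right p q a b : period_on w p a b -> period_on w q a b.+1 ->
  0 < q -> p + q <= b - a -> period_on w p a b.+1.
Proof.
move=> per_p per_q q_gt0 le_pq m le_m; rewrite ltnS leq_eqVlt => /predU1P[def_m|]; last exact: per_p.
have le_am : a + q <= m by lia.
have -> : w m = w (m - q) by rewrite [RHS]per_q; [congr (w _)| |]; lia.
rewrite per_p; [|lia|lia].
by rewrite per_q; [congr (w _)| |]; lia.
Qed.

(** Extend the power as far as possible with the same period p, to the left and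
    then to the right; the latter stops since w is not ultimately periodic. If
    one more letter gave a power with some period q, then p + q would be at most
    the length, as k >= 2, so p would be a period of the longer word too. *)
Lemma extend_to_run p x y : power_on p x y -> exists i j,
  [/\ i <= x, y <= j.+1, is_run w k i j & period_on w p i j.+1].
Proof.
move=> [p_gt0 le_p per]; have lt_xy : x < y by nia.
pose L i := (i <= x) && `[< period_on w p i y >].
have exL : exists i, L i by exists x; rewrite /L leqnn; apply/asboolP.
case: (ex_minnP exL) => i /andP[le_ix /asboolP per_i] min_i.
pose R j := `[< period_on w p i j >].
have [T ubR] : exists T, forall j, R j -> j <= T.
  apply: contrapT => /forallNP noT; apply: aperiodic; exists i, p; split=> // m le_im.
  have /existsNP[j /not_implyP[/asboolP per_j lt_j]] := noT (m + p).
  by symmetry; apply: per_j => //; rewrite ltnNge; apply/negP.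
have exR : exists j, R j by exists y; apply/asboolP.
case: (ex_maxnP exR ubR) => j /asboolP per_j max_j.
have le_yj : y <= j by apply: max_j; apply/asboolP.
case: j per_j max_j le_yj => [|j] per_j max_j le_yj; first lia.
have le_pij : k * p <= j.+1 - i by lia.
exists i, j; split=> //; split; first lia.
- by apply/(is_power_ge_fac (j := j.+1)); [lia | exists p].
- move=> i_gt0 /(is_power_ge_fac (j := j.+1))[|q [q_gt0 le_q per_q]]; first lia.
  have : i <= i.-1; last lia.
  apply: min_i; apply/andP; split; first lia.
  apply/asboolP/(period_on_sub (y := j.+1) _ (leqnn _) le_yj).
  apply: (@period_on_extend_left p q) => //; first by rewrite prednK.
  by nia.
move=> /(is_power_ge_fac (j := j.+2))[|q [q_gt0 le_q per_q]]; first lia.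
have : j.+2 <= j.+1; last lia.
by apply/max_j/asboolP/(@period_on_extend_right p q) => //; nia.
Qed.

(** The runs of a nested tower have periods smaller than the minimal period p of
    the outermost power, because k >= 2. So none of them contains that power, as
    it would inherit the smaller period; hence its run is a new one. *)
Lemma tower_runs d x y : tower d x y -> x < y -> exists n rs,
  [/\ x <= n < y, uniq rs, size rs = d &
      forall r, r \in rs -> [/\ is_run w k r.1 r.2, r.1 <= n <= r.2 &
        exists q, [/\ 0 < q, k * q <= y - x & period_on w q r.1 r.2.+1]]].
Proof.
elim: d x y => [|d IHd] x y.
  by move=> _ lt_xy; exists x, [::]; rewrite leqnn.
move=> [a [b [p [a' [b' [le_xa le_by pow min_p [le_a lt_ab le_b le_p tow]]]]]]] lt_xy.
have [n [rs [/andP[le_an lt_nb] uniq_rs sz_rs rsP]]] := IHd a' b' tow lt_ab.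
have [i [j [le_ia le_bj run_ij per_ij]]] := extend_to_run pow.
have [p_gt0 le_kp _] := pow.
exists n, ((i, j) :: rs); split; rewrite /= ?sz_rs //; first lia.
  rewrite uniq_rs andbT; apply/negP => /rsP[_ _ [q [q_gt0 le_q /= per_q]]].
  have := min_p q q_gt0 (period_on_sub per_q le_ia le_bj); nia.
move=> r; rewrite inE => /predU1P[-> /=|/rsP[run_r n_in [q [q_gt0 le_q per_q]]]].
  by split=> //; [lia | exists p; split=> //; lia].
by split=> //; exists q; split=> //; lia.
Qed.

Lemma kl_condition_tower l d x y :
  (forall n, (runs_covering w k n #<= `I_l)%card) -> tower d x y -> x < y -> d <= l.
Proof.
move=> few tow lt_xy; have [n [rs [_ uniq_rs sz_rs rsP]]] := tower_runs tow lt_xy.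
pose f m := nth (0, 0) rs m.
rewrite -card_le_II; apply: card_le_trans (few n).
have inj_f : {in `I_d &, injective f}.
  move=> m1 m2; rewrite !inE /= -sz_rs => lt_m1 lt_m2 /eqP.
  by rewrite nth_uniq // => /eqP.
rewrite -(card_le_eql (inj_card_eq inj_f)); apply: subset_card_le => _ [m /= lt_m <-].
have [|run_r n_in _] := rsP (f m); first by rewrite mem_nth // sz_rs.
by split.
Qed.

End Towers.

Theorem theorem8 (A : finType) (A_nonempty : 0 < #|A|) (w : nat -> A)
    (k l : nat) (k_ge2 : 2 <= k) (w_kl : kl_condition w k l)
    (P : nat) (P_gt0 : 0 < P) :
  exists u : seq A, factor w u /\ P < pal_length u.
Proof.
have [aper few] := w_kl.
have [B Bfam richB] : exists2 B, block_family B & rich w k B.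
  have [B Bfam [richB|[unsB towB]]] := rich_or_tower k_ge2 aper l.+1; first by exists B.
  exists B => // M; have [y nsy] := unsB M; exists 0, y; split=> // p a b _ _ pow.
  apply: contrapT => nB; have := towB p a b pow nB.
  have lt_ab : a < b by case: pow; nia.
  by move/(kl_condition_tower k_ge2 aper few)/(_ lt_ab); rewrite ltnn.
have [M splitsM] := few_blocks P (ltnW k_ge2).
have [x [y [le_xy nsM powB]]] := richB M.
apply: contrapT => short; apply: nsM; apply: splitsM => // [p a b p_gt0 le_a le_b le_p per|z].
  by apply: (powB p).
case/andP; rewrite leq_eqVlt => /predU1P[<- _|lt_xz le_zy].
  (* The empty prefix has palindromic length 0. *)
  rewrite fac_nil /pal_length; case: ex_minnP => n _ /(_ 0) min_n.
  by apply: leq_trans (min_n _) _ => //; apply/asboolP; exists [::].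
rewrite leqNgt; apply/negP => lt_P; apply: short; exists (fac w x z); split=> //.
by exists x, z.-1; rewrite /subword /index_iota /fac prednK //; lia.
Qed.
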